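(* Let $b\in\mathbb N_0$ and $k,N\in\mathbb N$ be such that $b+k\le N$, and let $\lambda\in\mathbb{GT}_N$. Then $$\frac{s_\lambda(1,q,\ldots,q^{b-1},q^bx_1,\ldots,q^bx_k,q^{b+k},\ldots,q^{N-1})}{s_\lambda(1,q,\ldots,q^{N-1})}=\frac{q^{\frac{k(k-1)(2k-1)}{6}}}{V(x_k,\ldots,x_1)}$$ $$\times\det_{1\le i,j\le k}\left[\frac{s_\lambda(1,q,\ldots,q^{b+j-2},q^bx_i,q^{b+j},\ldots,q^{N-1})}{s_\lambda(1,q,\ldots,q^{N-1})}\prod_{\substack{1\le s\le k\\ s\ne j}}(x_iq^{1-s}-1)\right].$$
   Context: $q\in(0,1)$ is a fixed parameter. $\mathbb N=\{1,2,\ldots\}$ and $\mathbb N_0=\mathbb N\cup\{0\}$. $\mathbb{GT}_N$ is the set of $\lambda=(\lambda_1,\ldots,\lambda_N)\in\mathbb Z^N$ with $\lambda_1\ge\cdots\ge\lambda_N$. $V(x_1,\ldots,x_N)=\prod_{1\le i<j\le N}(x_i-x_j)$ is the Vandermonde determinant, so that $V(x_k,\ldots,x_1)=\prod_{1\le i<j\le k}(x_j-x_i)$, and $s_\lambda(x_1,\ldots,x_N)=\det_{1\le i,j\le N}[x_i^{\lambda_j+N-j}]/V(x_1,\ldots,x_N)$ is the Schur (Laurent) polynomial. In the $(i,j)$ entry of the determinant the arguments of $s_\lambda$ in the numerator are $1,q,\ldots,q^{N-1}$ with $q^{b+j-1}$ replaced by $q^bx_i$. Both sides are rational functions of the variables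 $x_1,\ldots,x_k$.
   Formalization: The right-hand side is additionally divided by the product over 1≤i<j≤k of (1−q^{j−i}); as printed the formula is false for every k≥2 (for λ=(0,0), b=0, k=N=2 it gives 1−q instead of 1), and for k=1 the two agree. *)

(* Defs.v *)
From mathcomp Require Import all_boot all_order all_algebra.
From mathcomp Require Import mpoly.

Set Implicit Arguments.
Unset Strict Implicit.
Unset Printing Implicit Defensive.

Import Order.TTheory GRing.Theory Num.Theory.
Local Open Scope ring_scope.

(* Indices are 0-based throughout: position i : 'I_n stands for the index i + 1
   of the usual 1-based formulas. *)

Definition GT (N : nat) (lambda : 'I_N -> int) : Prop :=
  forall i j : 'I_N, (i <= j)%N -> lambda j <= lambda i.

Definition vandermonde (F : comNzRingType) (n : nat) (x : 'I_n -> F) : F :=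
  \prod_(i < n) \prod_(j < n | (i < j)%N) (x i - x j).

(* The 1-based exponent lambda_j + N - j is lambda j + (N - (j + 1)); the nat
   subtraction does not truncate, and the power is the integer power of [exprz].
   The quotient is the value of the Schur Laurent polynomial only at nonzero,
   pairwise distinct arguments. *)
Definition schur (F : fieldType) (N : nat) (lambda : 'I_N -> int)
    (y : 'I_N -> F) : F :=
  \det (\matrix_(i < N, j < N) y i ^ (lambda j + (N - j.+1)%N%:Z))
  / vandermonde y.

(* [args] turns a list of length N into an N-tuple of arguments; every list
   below has exactly N entries, so the default value of [nth] is never used. *)
Definition args (F : fieldType) (N : nat) (s : seq F) : 'I_N -> F :=
  fun m => s`_m.

(* q^m, q^(m+1), ..., q^(n-1) *)
Definition qpowers (F : fieldType) (q : F) (m n : nat) : seq F :=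
  [seq q ^+ l | l <- index_iota m n].

(* s_lambda(1, q, ..., q^(N-1)) *)
Definition schur_principal (F : fieldType) (q : F) (N : nat)
    (lambda : 'I_N -> int) : F :=
  schur lambda (args (qpowers q 0 N)).

(* s_lambda(1, ..., q^(b-1), q^b x_1, ..., q^b x_k, q^(b+k), ..., q^(N-1)) *)
Definition schur_block (F : fieldType) (q : F) (N : nat) (lambda : 'I_N -> int)
    (b k : nat) (x : 'I_k -> F) : F :=
  schur lambda (args (qpowers q 0 b ++ [seq q ^+ b * x i | i <- enum 'I_k]
                      ++ qpowers q (b + k) N)).

(* s_lambda(1, q, ..., q^(N-1)) with the entry q^(b+j) replaced by q^b z *)
Definition schur_single (F : fieldType) (q : F) (N : nat) (lambda : 'I_N -> int)
    (b j : nat) (z : F) : F :=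
  schur lambda (args (qpowers q 0 (b + j)
                      ++ q ^+ b * z :: qpowers q (b + j).+1 N)).

(* Identities between rational functions of x_1, ..., x_k are stated in the
   field R(x_1, ..., x_k). There the arguments of every [schur] above are
   nonzero and pairwise distinct when 0 < q < 1. *)
Definition ratfun (R : realFieldType) (k : nat) : fieldType :=
  {fraction {mpoly R[k]}}.

Definition ratconst (R : realFieldType) (k : nat) (c : R) : ratfun R k :=
  tofrac (c%:MP_[k]).

Definition ratvar (R : realFieldType) (k : nat) (i : 'I_k) : ratfun R k :=
  tofrac ('X_i : {mpoly R[k]}).

(* prod_(1 <= i < j <= k) (1 - q^(j - i)), which is V(1, q, ..., q^(k-1)) up to
   a power of q. It is the normalization of the determinant formula that remains
   once that power is extracted, and cannot be dropped: for lambda = (0, 0),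
   b = 0, k = N = 2 the Schur ratios are 1 and the formula without it gives
   1 - q instead of 1. *)
Definition qvandermonde (F : fieldType) (q : F) (k : nat) : F :=
  \prod_(i < k) \prod_(j < k | (i < j)%N) (1 - q ^+ (j - i)).

(* Main.v *)
Require Import Defs.
From mathcomp Require Import all_boot all_order all_algebra.
From mathcomp Require Import mpoly.
From mathcomp Require Import zify ring.

(** Write [D y] for the determinant of the matrix with entries [phi_j (y_m)],
    [V y] for the Vandermonde product, and consider the ratio [S = D / V], of
    which a Schur Laurent polynomial is the case [phi_j w = w ^ l_j]. Start from
    nodes [y] and replace a block of [k] consecutive nodes [eta_1, ..., eta_k]
    by new values [z_1, ..., z_k].

    Numerators. Multiply the matrix of the new nodes by the inverse of the
    matrix of the old ones. The rows outside the block become rows of the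
    identity, so [D z / D y] is a [k] by [k] minor of the product, and Cramer's
    rule identifies the [(i, j)] entry of this minor as [D y_ij / D y], where
    [y_ij] is [y] with the single node [eta_j] replaced by [z_i]. This is
    [det_alternant_block].

    Denominators. As a function of the nodes in the block, [V] is the
    Vandermonde product of the block times a product of values [G (node)] of one
    function [G] that depends only on the nodes outside the block. Hence
    [V y_ij / V y] is [G z_i / G eta_j] times the Lagrange basis polynomial of
    [eta_j] at [z_i], as in [vandermonde_replace_mid]. The factors [G z_i] and
    [1 / G eta_j] come out of the rows and columns of the determinant and cancel
    against those of [V z / V y]. What remains is [generalized_schur_block]: up
    to [V eta / V z], the ratio for the whole block is the determinant of the
    ratios for single replacements, each multiplied by a Lagrange basis
    polynomial.

    For [eta_s = q^(b+s)] and [z_i = q^b x_i] the powers of [q^b] cancel, and the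
    constants are products over pairs [i < j], which are compared pair by pair
    in [vandermonde_qpowers_ratio]. Each pair contributes a factor [q^j]; since
    there are [j] values of [i] below [j], this gives [q] to the sum of the
    squares [j^2], which is the stated exponent. *)

Set Implicit Arguments.
Unset Strict Implicit.
Unset Printing Implicit Defensive.

Import Order.TTheory GRing.Theory Num.Theory.
Local Open Scope ring_scope.

(** * Replacing a block of rows of a determinant *)

Definition mid (b k c : nat) (i : 'I_k) : 'I_(b + (k + c)) :=
  rshift b (lshift c i).

Definition agree_off_mid (T : Type) (b k c : nat)
    (y z : 'I_(b + (k + c)) -> T) : Prop :=
  forall m, (forall i : 'I_k, m != mid b c i) -> z m = y m.

Lemma mid_inj (b k c : nat) : injective (@mid b k c).
Proof. by move=> i j /rshift_inj /lshift_inj. Qed.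

Lemma lshift_neq_mid (b k c : nat) (i : 'I_b) (j : 'I_k) :
  lshift (k + c) i != mid b c j.
Proof. by rewrite eq_lrshift. Qed.

Lemma rshift_neq_mid (b k c : nat) (i : 'I_c) (j : 'I_k) :
  rshift b (rshift k i) != mid b c j.
Proof. by rewrite eq_rshift eq_rlshift. Qed.

(** The block shape is lower triangular for the first [b] indices and, after
    these are removed, upper triangular for the last [c] ones, with identity
    blocks in both corners. *)
Lemma det_unit_off_mid (F : comNzRingType) (b k c : nat)
    (C : 'M[F]_(b + (k + c))) :
  (forall m, (forall i : 'I_k, m != mid b c i) ->
     forall j, C m j = (m == j)%:R) ->
  \det C = \det (\matrix_(i < k, j < k) C (mid b c i) (mid b c j)).
Proof.
move=> unitC; rewrite -[in LHS](submxK C).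
have -> : ulsubmx C = 1%:M.
  apply/matrixP=> i j.
  by rewrite !mxE (unitC _ (@lshift_neq_mid _ _ _ _)) eq_lshift.
have -> : ursubmx C = 0.
  apply/matrixP=> i j.
  by rewrite !mxE (unitC _ (@lshift_neq_mid _ _ _ _)) eq_lrshift.
rewrite det_lblock det1 mul1r -[drsubmx C]submxK.
have -> : dlsubmx (drsubmx C) = 0.
  apply/matrixP=> i j.
  by rewrite !mxE (unitC _ (@rshift_neq_mid _ _ _ _)) eq_rshift eq_rlshift.
have -> : drsubmx (drsubmx C) = 1%:M.
  apply/matrixP=> i j.
  by rewrite !mxE (unitC _ (@rshift_neq_mid _ _ _ _)) !eq_rshift.
rewrite det_ublock det1 mulr1; congr (\det _).
by apply/matrixP=> i j; rewrite !mxE.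
Qed.

Definition replace (T : Type) (n : nat) (y : 'I_n -> T) (p : 'I_n) (w : T) :
    'I_n -> T :=
  fun i => if i == p then w else y i.

Definition alternant (F : fieldType) (N : nat) (phi : 'I_N -> F -> F)
    (y : 'I_N -> F) : 'M[F]_N :=
  \matrix_(i < N, j < N) phi j (y i).

(** Cramer's rule: the cofactors along row [p] do not see the replaced row, so
    expanding along it pairs the new row with a column of the inverse. *)
Lemma det_alternant_replace (F : fieldType) (N : nat) (phi : 'I_N -> F -> F)
    (y : 'I_N -> F) (p : 'I_N) (w : F) :
  \det (alternant phi y) != 0 ->
  \det (alternant phi (replace y p w)) / \det (alternant phi y) =
    ((\row_j phi j w) *m invmx (alternant phi y)) 0 p.
Proof.
set A := alternant phi y => detA_neq0.
rewrite /invmx unitmxE unitfE detA_neq0 -scalemxAr !mxE mulrC.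
congr (_ * _); rewrite (expand_det_row _ p); apply: eq_bigr => j _.
rewrite !mxE /replace eqxx; congr (_ * (_ * \det _)).
by apply/matrixP=> i l; rewrite !mxE /replace eq_sym (negbTE (neq_lift p i)).
Qed.

(** In the product of the matrix of [z] by the inverse of the matrix of [y], the
    rows off the block are those of the identity because [z] and [y] agree
    there; the entries in the block are given by Cramer's rule. *)
Lemma det_alternant_block (F : fieldType) (b k c : nat)
    (phi : 'I_(b + (k + c)) -> F -> F) (y z : 'I_(b + (k + c)) -> F) :
  agree_off_mid y z -> \det (alternant phi y) != 0 ->
  \det (alternant phi z) / \det (alternant phi y) =
    \det (\matrix_(i < k, j < k)
      (\det (alternant phi (replace y (mid b c j) (z (mid b c i))))
       / \det (alternant phi y))).
Proof.
move=> yz detA_neq0.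
have unitA : alternant phi y \in unitmx by rewrite unitmxE unitfE.
pose C := alternant phi z *m invmx (alternant phi y).
have rowC m j : C m j =
    ((\row_l phi l (z m)) *m invmx (alternant phi y)) 0 j.
  by rewrite !mxE; apply: eq_bigr => l _; rewrite !mxE.
rewrite -[in LHS]det_inv -det_mulmx -/C det_unit_off_mid => [|m mP j].
  congr (\det _); apply/matrixP=> i j.
  by rewrite [LHS]mxE [RHS]mxE rowC det_alternant_replace.
have -> : C m j = (alternant phi y *m invmx (alternant phi y)) m j.
  by rewrite rowC !mxE; apply: eq_bigr => l _; rewrite !mxE yz.
by rewrite mulmxV // mxE.
Qed.

(** * Vandermonde products under replacement of nodes *)

Lemma vandermonde_cat (F : comNzRingType) (m n : nat) (y : 'I_(m + n) -> F) :
  vandermonde y =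
    vandermonde (fun i => y (lshift n i))
    * vandermonde (fun i => y (rshift m i))
    * \prod_(i < m) \prod_(j < n) (y (lshift n i) - y (rshift m j)).
Proof.
rewrite /vandermonde big_split_ord /= mulrAC -big_split /=; congr (_ * _).
  apply: eq_bigr => i _; rewrite big_split_ord /=; congr (_ * _).
  by apply: eq_bigl => j; rewrite ltn_addr.
apply: eq_bigr => i _; rewrite big_split_ord /= big_pred0 ?mul1r => [|j].
  by apply: eq_bigl => j; rewrite ltn_add2l.
by apply/negbTE; rewrite -leqNgt; apply: leq_trans (leq_addr _ _); apply: ltnW.
Qed.

Lemma prod_offdiag (F : comNzRingType) (n : nat) (f : 'I_n -> 'I_n -> F) :
  \prod_j \prod_(s | s != j) f j s =
    \prod_(i < n) \prod_(j < n | (i < j)%N) (f i j * f j i).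
Proof.
rewrite (eq_bigr (fun i : 'I_n => \prod_(j < n | (i < j)%N) f i j
    * \prod_(j < n | (j < i)%N) f i j)) => [|i _].
  rewrite big_split /= [X in _ * X](exchange_big_dep xpredT) //= -big_split /=.
  by apply: eq_bigr => i _; rewrite -big_split.
rewrite (bigID (fun j : 'I_n => (i < j)%N)) /=; congr (_ * _).
  by apply: eq_bigl => j; rewrite -val_eqE /= neq_ltn; case: ltngtP.
by apply: eq_bigl => j; rewrite -val_eqE /= neq_ltn; case: ltngtP.
Qed.

(** Isolates the pairs that involve the index [p]. The first factor depends only
    on the values of [h] away from [p], so it cancels when a single node is
    changed. *)
Lemma prod_pairs_at (F : comNzRingType) (n : nat) (h : 'I_n -> 'I_n -> F)
    (p : 'I_n) :
  \prod_(i < n) \prod_(j < n | (i < j)%N) h i j =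
    (\prod_(i < n | i != p) \prod_(j < n | (i < j)%N && (j != p)) h i j)
    * \prod_(s | s != p) (if (s < p)%N then h s p else h p s).
Proof.
rewrite (bigD1 p) //= mulrC [X in _ = _ * X](bigID (fun s : 'I_n => (s < p)%N)).
rewrite mulrA; congr (_ * _).
  rewrite [X in _ = _ * X]big_mkcondr -big_split; apply: eq_bigr => i ip /=.
  have [ltip|leqpi] := boolP (i < p)%N; first by rewrite (bigD1 p) //= mulrC.
  rewrite mulr1; apply: eq_bigl => j; case: (eqVneq j p) => [->|].
    by rewrite (negbTE leqpi).
  by rewrite andbT.
rewrite [RHS](eq_bigl (fun j : 'I_n => (p < j)%N)) => [|j].
  by apply: eq_bigr => j ltpj; rewrite ltnNge ltnW.
by rewrite -val_eqE neq_ltn; case: ltngtP.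
Qed.

(** A Vandermonde product is, in each of its nodes, a multiple of the product of
    the differences with the other nodes. The signs of the two sides agree
    because the position [p] is the same. *)
Lemma vandermonde_replace (F : comNzRingType) (n : nat) (y : 'I_n -> F)
    (p : 'I_n) (w : F) :
  vandermonde (replace y p w) * \prod_(s | s != p) (y p - y s) =
    vandermonde y * \prod_(s | s != p) (w - y s).
Proof.
rewrite /vandermonde !(prod_pairs_at _ p) -!mulrA; congr (_ * _).
  apply: eq_bigr => i ip; apply: eq_bigr => j /andP[_ jp]; rewrite /replace.
  by rewrite (negbTE ip) (negbTE jp).
rewrite -!big_split; apply: eq_bigr => s sp.
by rewrite /replace (negbTE sp) eqxx; have [_|_] /= := boolP (s < p)%N; ring.
Qed.

Lemma det_scale (F : comNzRingType) (n : nat) (A : 'M[F]_n) (r c : 'I_n -> F) :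
  \det (\matrix_(i, j) (r i * A i j * c j)) =
    \prod_i r i * \det A * \prod_j c j.
Proof.
transitivity (\det (diag_mx (\row_i r i) *m A *m diag_mx (\row_j c j))).
  congr (\det _); apply/matrixP=> i j.
  by rewrite mul_mx_diag mul_diag_mx !mxE.
rewrite !det_mulmx !det_diag.
by congr (_ * _ * _); apply: eq_bigr => i _; rewrite mxE.
Qed.

Lemma vandermonde_neq0 (F : fieldType) (n : nat) (y : 'I_n -> F) :
  injective y -> vandermonde y != 0.
Proof.
move=> y_inj; apply/prodf_neq0 => i _; apply/prodf_neq0 => j ltij.
by rewrite subr_eq0 (inj_eq y_inj) -val_eqE neq_ltn ltij.
Qed.

(** Product of the differences between [w], placed in the block, and the nodes
    outside the block: up to a sign independent of [w], the monic polynomial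
    whose roots are these outer nodes. *)
Definition off_mid_factor (F : comNzRingType) (b k c : nat)
    (y : 'I_(b + (k + c)) -> F) (w : F) : F :=
  (\prod_(i < b) (y (lshift (k + c) i) - w))
  * \prod_(j < c) (w - y (rshift b (rshift k j))).

Definition off_mid_vandermonde (F : comNzRingType) (b k c : nat)
    (y : 'I_(b + (k + c)) -> F) : F :=
  vandermonde (fun i => y (lshift (k + c) i))
  * vandermonde (fun j => y (rshift b (rshift k j)))
  * \prod_(i < b) \prod_(j < c)
      (y (lshift (k + c) i) - y (rshift b (rshift k j))).

Lemma vandermonde_mid (F : comNzRingType) (b k c : nat)
    (y : 'I_(b + (k + c)) -> F) :
  vandermonde y =
    vandermonde (y \o @mid b k c)
    * (\prod_(s < k) off_mid_factor y (y (mid b c s)))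
    * off_mid_vandermonde y.
Proof.
rewrite /off_mid_vandermonde.
rewrite vandermonde_cat (vandermonde_cat (fun i => y (rshift b i))) /=.
rewrite (eq_bigr (fun i : 'I_b =>
    \prod_(j < k) (y (lshift (k + c) i) - y (mid b c j)) *
    \prod_(j < c) (y (lshift (k + c) i) - y (rshift b (rshift k j)))))
  => [|i _].
  rewrite !big_split /= [X in _ * (X * _) = _]exchange_big /=.
  rewrite /vandermonde /mid /=; ring.
by rewrite big_split_ord.
Qed.

(** [off_mid_factor] and [off_mid_vandermonde] read only the nodes off the
    block, where [y] and [z] agree. *)
Lemma vandermonde_mid_ratio (F : fieldType) (b k c : nat)
    (y z : 'I_(b + (k + c)) -> F) :
  injective y -> agree_off_mid y z ->
  vandermonde z / vandermonde y =
    vandermonde (z \o @mid b k c) / vandermonde (y \o @mid b k c)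
    * ((\prod_(s < k) off_mid_factor y (z (mid b c s)))
       / \prod_(s < k) off_mid_factor y (y (mid b c s))).
Proof.
move=> y_inj yz.
have zl i : z (lshift (k + c) i) = y (lshift (k + c) i).
  exact/yz/lshift_neq_mid.
have zr j : z (rshift b (rshift k j)) = y (rshift b (rshift k j)).
  exact/yz/rshift_neq_mid.
have -> : vandermonde z = vandermonde (z \o @mid b k c)
    * (\prod_(s < k) off_mid_factor y (z (mid b c s)))
    * off_mid_vandermonde y.
  rewrite vandermonde_mid; congr (_ * _ * _).
    apply: eq_bigr => s _; congr (_ * _).
      by apply: eq_bigr => i _; rewrite zl.
    by apply: eq_bigr => j _; rewrite zr.
  congr (_ * _ * _).
  - by apply: eq_bigr => i _; apply: eq_bigr => j _; rewrite !zl.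
  - by apply: eq_bigr => i _; apply: eq_bigr => j _; rewrite !zr.
  - by apply: eq_bigr => i _; apply: eq_bigr => j _; rewrite zl zr.
have := vandermonde_neq0 y_inj.
rewrite vandermonde_mid mulf_eq0 negb_or => /andP[].
rewrite mulf_eq0 negb_or => /andP[Vmid_neq0 G_neq0] K_neq0.
by field; rewrite G_neq0 Vmid_neq0.
Qed.

Lemma off_mid_factor_neq0 (F : fieldType) (b k c : nat)
    (y : 'I_(b + (k + c)) -> F) (s : 'I_k) :
  injective y -> off_mid_factor y (y (mid b c s)) != 0.
Proof.
move=> y_inj; have := vandermonde_neq0 y_inj.
rewrite vandermonde_mid mulf_eq0 negb_or => /andP[].
by rewrite mulf_eq0 negb_or => /andP[_ /prodf_neq0 ->].
Qed.

Lemma replace_comp (T : Type) (m n : nat) (f : 'I_m -> 'I_n) (y : 'I_n -> T)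
    (p : 'I_m) (w : T) :
  injective f -> replace y (f p) w \o f =1 replace (y \o f) p w.
Proof. by move=> f_inj i; rewrite /replace /= (inj_eq f_inj). Qed.

Lemma eq_vandermonde (F : comNzRingType) (n : nat) (y z : 'I_n -> F) :
  y =1 z -> vandermonde y = vandermonde z.
Proof.
by move=> yz; apply: eq_bigr => i _; apply: eq_bigr => j _; rewrite !yz.
Qed.

(** The product over [s] is the Lagrange basis polynomial of the [j]-th node of
    the block, evaluated at [w]. *)
Lemma vandermonde_replace_mid (F : fieldType) (b k c : nat)
    (y : 'I_(b + (k + c)) -> F) (j : 'I_k) (w : F) :
  injective y ->
  vandermonde (replace y (mid b c j) w) / vandermonde y =
    \prod_(s < k | s != j)
      ((w - y (mid b c s)) / (y (mid b c j) - y (mid b c s)))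
    * (off_mid_factor y w / off_mid_factor y (y (mid b c j))).
Proof.
move=> y_inj; rewrite vandermonde_mid_ratio // => [|m mP]; last first.
  by rewrite /replace (negbTE (mP j)).
have eta_inj : injective (y \o @mid b k c).
  by move=> i i' /y_inj; apply: mid_inj.
have G_neq0 s : off_mid_factor y (y (mid b c s)) != 0.
  exact: off_mid_factor_neq0.
congr (_ * _).
  rewrite (eq_vandermonde (replace_comp _ _ _ (@mid_inj b k c))) prodf_div.
  apply/eqP; rewrite eqr_div ?vandermonde_neq0 //.
    by rewrite vandermonde_replace mulrC.
  apply/prodf_neq0 => s sj.
  by rewrite subr_eq0 (inj_eq y_inj) (inj_eq (@mid_inj _ _ _)) eq_sym.
rewrite -prodf_div (bigD1 j) //= [X in _ * X]big1 ?mulr1 => [|s sj].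
  by rewrite /replace eqxx.
by rewrite /replace (inj_eq (@mid_inj _ _ _)) (negbTE sj) divff.
Qed.

Lemma replace_inj (T : eqType) (n : nat) (y : 'I_n -> T) (p : 'I_n) (w : T) :
  injective y -> (forall m, m != p -> w != y m) -> injective (replace y p w).
Proof.
move=> y_inj wP m m'; rewrite /replace.
case: (eqVneq m p) => [->|mp]; case: (eqVneq m' p) => [-> //|m'p].
- by move/eqP; rewrite (negbTE (wP _ m'p)).
- by move/eqP; rewrite eq_sym (negbTE (wP _ mp)).
- exact: y_inj.
Qed.

(** * The determinant formula for a replaced block of nodes *)

Definition generalized_schur (F : fieldType) (N : nat) (phi : 'I_N -> F -> F)
    (y : 'I_N -> F) : F :=
  \det (alternant phi y) / vandermonde y.

(** The row factors [G (z_i)] and the column factors [1 / G (y_j)], which relate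
    the quotients of alternants to those of the normalized ratios, are exactly
    the ones by which [vandermonde z / vandermonde y] differs from the quotient
    of the Vandermonde products of the blocks. *)
Lemma generalized_schur_block (F : fieldType) (b k c : nat)
    (phi : 'I_(b + (k + c)) -> F -> F) (y z : 'I_(b + (k + c)) -> F) :
  (0 < k)%N -> injective y -> injective z -> agree_off_mid y z ->
  (forall i s, z (mid b c i) != y (mid b c s)) ->
  generalized_schur phi z / generalized_schur phi y =
    vandermonde (y \o @mid b k c) / vandermonde (z \o @mid b k c)
    * \det (\matrix_(i < k, j < k)
        (generalized_schur phi (replace y (mid b c j) (z (mid b c i)))
         / generalized_schur phi y
         * \prod_(s < k | s != j)
             ((z (mid b c i) - y (mid b c s))
              / (y (mid b c j) - y (mid b c s))))).
Proof.
move=> k_gt0 y_inj z_inj yz zy.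
(* Since x / 0 = 0, both sides vanish when the ratio at [y] does; on the right
   this needs a row to expand along. *)
have [Sy0|Sy_neq0] := eqVneq (generalized_schur phi y) 0.
  have i0 : 'I_k := Ordinal k_gt0.
  rewrite Sy0 invr0 mulr0 (expand_det_row _ i0) big1 ?mulr0 // => j _.
  by rewrite mxE mulr0 !mul0r.
have Vy_neq0 := vandermonde_neq0 y_inj.
have Vz_neq0 := vandermonde_neq0 z_inj.
have Dy_neq0 : \det (alternant phi y) != 0.
  by apply: contraNneq Sy_neq0 => Dy0; rewrite /generalized_schur Dy0 mul0r.
pose G := off_mid_factor y.
have Gy_neq0 s : G (y (mid b c s)) != 0.
  exact: off_mid_factor_neq0.
have := vandermonde_mid_ratio y_inj yz.
set Ve := vandermonde (y \o _); set Vx := vandermonde (z \o _) => ratio_V.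
have Vx_neq0 : Vx != 0 by apply: vandermonde_neq0 => i j /z_inj; apply: mid_inj.
have Ve_neq0 : Ve != 0 by apply: vandermonde_neq0 => i j /y_inj; apply: mid_inj.
set E := \matrix_(i, j) _.
have ratio_D : \det (alternant phi z) / \det (alternant phi y) =
    (\prod_i G (z (mid b c i))) * \det E / \prod_j G (y (mid b c j)).
  rewrite (det_alternant_block yz Dy_neq0) -prodfV -det_scale.
  congr (\det _); apply/matrixP=> i j; rewrite [LHS]mxE [RHS]mxE [E i j]mxE.
  have Vij : vandermonde (replace y (mid b c j) (z (mid b c i))) != 0.
    apply/vandermonde_neq0/replace_inj => // m mj.
    have [/existsP[s /eqP ->] //|off] := boolP [exists s, m == mid b c s].
    rewrite -yz => [|s]; last by move: off; rewrite negb_exists => /forallP.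
    rewrite (inj_eq z_inj) eq_sym.
    by move: off; rewrite negb_exists => /forallP.
  have := vandermonde_replace_mid j (z (mid b c i)) y_inj.
  rewrite /generalized_schur -!/(G _); set L := \prod_(s < k | _) _ => ratio_ij.
  have Vij_eq : vandermonde (replace y (mid b c j) (z (mid b c i)))
      = L * (G (z (mid b c i)) / G (y (mid b c j))) * vandermonde y.
    by rewrite -ratio_ij divfK.
  move: Vij; rewrite Vij_eq => Vij.
  have [L_neq0 Gz_neq0] : L != 0 /\ G (z (mid b c i)) != 0.
    by split; apply: contraNneq Vij => ->; rewrite ?mul0r ?mulr0 ?mul0r.
  by field; rewrite Dy_neq0 Vy_neq0 L_neq0 Gz_neq0 Gy_neq0.
have Gz_neq0 : \prod_i G (z (mid b c i)) != 0.
  apply: contraNneq Vz_neq0; rewrite -(divfK Vy_neq0 (vandermonde z)) ratio_V.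
  by move=> ->; rewrite mul0r mulr0 mul0r.
have Gy_prod_neq0 : \prod_i G (y (mid b c i)) != 0 by apply/prodf_neq0.
rewrite /generalized_schur.
transitivity (\det (alternant phi z) / \det (alternant phi y)
              / (vandermonde z / vandermonde y)).
  by field; rewrite Vz_neq0 Dy_neq0 Vy_neq0.
rewrite ratio_D ratio_V -!/(G _); field.
by rewrite Gz_neq0 Gy_prod_neq0 Vx_neq0 Ve_neq0.
Qed.

Lemma eq_generalized_schur (F : fieldType) (N : nat) (phi : 'I_N -> F -> F)
    (y z : 'I_N -> F) :
  y =1 z -> generalized_schur phi y = generalized_schur phi z.
Proof.
move=> yz; rewrite /generalized_schur (eq_vandermonde yz).
by congr (\det _ / _); apply/matrixP=> i j; rewrite !mxE yz.
Qed.

(** * Geometric nodes *)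

Lemma nth_qpowers (F : fieldType) (q : F) (m n i : nat) :
  (i < n - m)%N -> (qpowers q m n)`_i = q ^+ (m + i).
Proof.
by move=> lti; rewrite (nth_map 0%N) ?size_iota // nth_iota.
Qed.

Lemma size_qpowers (F : fieldType) (q : F) (m n : nat) :
  size (qpowers q m n) = (n - m)%N.
Proof. by rewrite size_map size_iota. Qed.

Lemma args_principal (F : fieldType) (q : F) (N : nat) :
  args (qpowers q 0 N) =1 (fun m : 'I_N => q ^+ m).
Proof. by move=> m; rewrite /args nth_qpowers ?subn0. Qed.

Lemma args_block_mid (F : fieldType) (q : F) (b k c : nat) (x : 'I_k -> F)
    (i : 'I_k) :
  args (qpowers q 0 b ++ [seq q ^+ b * x i | i <- enum 'I_k]
        ++ qpowers q (b + k) (b + (k + c))) (mid b c i) = q ^+ b * x i.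
Proof.
rewrite /args /= nth_cat size_qpowers subn0 ltnNge leq_addr /= addKn.
rewrite nth_cat size_map size_enum_ord ltn_ord.
by rewrite (nth_map i) ?size_enum_ord // nth_ord_enum.
Qed.

Lemma args_block_off_mid (F : fieldType) (q : F) (b k c : nat) (x : 'I_k -> F) :
  agree_off_mid (fun m : 'I_(b + (k + c)) => q ^+ m)
    (args (qpowers q 0 b ++ [seq q ^+ b * x i | i <- enum 'I_k]
        ++ qpowers q (b + k) (b + (k + c)))).
Proof.
move=> m; rewrite /args nth_cat size_qpowers subn0.
case: (split_ordP m) => [i ->|r ->] mP /=.
  by rewrite nth_qpowers ?subn0.
rewrite addKn nth_cat size_map size_enum_ord.
case: (split_ordP r) mP => [i ->|s ->] mP /=.
  by have := mP i; rewrite eqxx.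
by rewrite addKn nth_qpowers ?addnA // addKn.
Qed.

Lemma args_single (F : fieldType) (q : F) (b k c : nat) (j : 'I_k) (w : F) :
  args (qpowers q 0 (b + j) ++ w :: qpowers q (b + j).+1 (b + (k + c)))
    =1 replace (fun m => q ^+ m) (mid b c j) w.
Proof.
move=> m; rewrite /args /replace nth_cat size_qpowers subn0 -val_eqE /=.
case: ltngtP => [ltm|ltm|->].
- by rewrite nth_qpowers ?subn0.
- rewrite -(subnSK ltm) /= nth_qpowers ?subnKC //.
  by rewrite ltn_sub2r // (leq_ltn_trans ltm).
- by rewrite subnn.
Qed.

Lemma prod_pairsM (F : comNzRingType) (n : nat) (f g : 'I_n -> 'I_n -> F) :
  (\prod_(i < n) \prod_(j < n | (i < j)%N) f i j)
  * (\prod_(i < n) \prod_(j < n | (i < j)%N) g i j) =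
    \prod_(i < n) \prod_(j < n | (i < j)%N) (f i j * g i j).
Proof. by rewrite -big_split; apply: eq_bigr => i _; rewrite -big_split. Qed.

Lemma prod_pairsV (F : fieldType) (n : nat) (f : 'I_n -> 'I_n -> F) :
  (\prod_(i < n) \prod_(j < n | (i < j)%N) f i j)^-1 =
    \prod_(i < n) \prod_(j < n | (i < j)%N) (f i j)^-1.
Proof. by rewrite -prodfV; apply: eq_bigr => i _; rewrite -prodfV. Qed.

Lemma vandermonde_rev (F : comNzRingType) (n : nat) (x : 'I_n -> F) :
  vandermonde (fun i => x (rev_ord i)) =
    \prod_(i < n) \prod_(j < n | (i < j)%N) (x j - x i).
Proof.
rewrite [RHS](exchange_big_dep xpredT) //=.
rewrite [LHS](reindex_inj rev_ord_inj); apply: eq_bigr => i _.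
rewrite [LHS](reindex_inj rev_ord_inj); apply: eq_big => j /=;
  last by rewrite !rev_ordK.
by rewrite ltn_sub2lE.
Qed.

Lemma sum_squares (n : nat) :
  (\sum_(j < n) j * j = (n * (n - 1) * (2 * n - 1)) %/ 6)%N.
Proof.
apply/esym; suff -> : (n * (n - 1) * (2 * n - 1) = (\sum_(j < n) j * j) * 6)%N.
  by rewrite mulnK.
elim: n => [|n IHn]; first by rewrite big_ord0.
rewrite big_ord_recr /= mulnDl -IHn; case: n {IHn} => // n.
have -> : (2 * n.+2 - 1 = 2 * n + 3)%N by lia.
have -> : (2 * n.+1 - 1 = 2 * n + 1)%N by lia.
by rewrite !subSS !subn0; ring.
Qed.

(** The factor [q^j] occurs once for each of the [j] indices below [j], which
    makes the exponent the sum of the [j^2]. *)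
Lemma prod_pairs_exp (F : comNzRingType) (q : F) (n : nat) :
  \prod_(i < n) \prod_(j < n | (i < j)%N) q ^+ j =
    q ^+ ((n * (n - 1) * (2 * n - 1)) %/ 6).
Proof.
rewrite -sum_squares (exchange_big_dep xpredT) //=.
rewrite -prodrXr; apply: eq_bigr => j _.
rewrite -(big_ord_widen n (fun=> q ^+ j) (ltnW (ltn_ord j))).
by rewrite prodr_const card_ord exprM.
Qed.

(** The double product collects the constants that relate the Lagrange factors
    [(x_i - q^s) / (q^j - q^s)] to [x_i q^(-s) - 1]. Both sides are products
    over the pairs [i < j], and the factors of each pair agree; the sign comes
    from the pair [(j, i)] of the double product, and it is absorbed by
    reversing the variables. *)
Lemma vandermonde_qpowers_ratio (F : fieldType) (q : F) (b k : nat)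
    (x : 'I_k -> F) :
  q != 0 -> (forall m, (0 < m)%N -> q ^+ m != 1) -> injective x ->
  vandermonde (fun s : 'I_k => q ^+ (b + s))
      / vandermonde (fun s : 'I_k => q ^+ b * x s)
    * \prod_(j < k) \prod_(s < k | s != j) (q ^+ s / (q ^+ j - q ^+ s)) =
  q ^+ ((k * (k - 1) * (2 * k - 1)) %/ 6)
    / (vandermonde (fun i => x (rev_ord i)) * qvandermonde q k).
Proof.
move=> q_neq0 q_root x_inj.
rewrite (prod_offdiag (fun j s : 'I_k => q ^+ s / (q ^+ j - q ^+ s))).
rewrite -prod_pairs_exp vandermonde_rev /vandermonde /qvandermonde.
rewrite invfM !prod_pairsV !prod_pairsM.
apply: eq_bigr => i _; apply: eq_bigr => j ltij.
rewrite !exprD.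
have -> : q ^+ j = q ^+ i * q ^+ (j - i) by rewrite -exprD subnKC // ltnW.
have qm_neq1 : 1 - q ^+ (j - i) != 0.
  by rewrite subr_eq0 eq_sym q_root // subn_gt0.
have xij : x i - x j != 0.
  by rewrite subr_eq0 (inj_eq x_inj) -val_eqE neq_ltn ltij.
field.
rewrite qm_neq1 -(opprB (x i)) oppr_eq0 xij.
have -> : q ^+ i * q ^+ (j - i) - q ^+ i = - (q ^+ i * (1 - q ^+ (j - i))).
  by ring.
have -> : q ^+ i - q ^+ i * q ^+ (j - i) = q ^+ i * (1 - q ^+ (j - i)) by ring.
by rewrite -mulrBr oppr_eq0 !mulf_neq0 ?expf_neq0.
Qed.

(** The last hypothesis keeps every [q^b x_i] away from all powers of [q],
    including the ones below [q^b]: divided by [q^b], these would be negative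
    powers, hence the form without division. *)
Lemma schur_block_det (F : fieldType) (q : F) (b k c : nat)
    (lambda : 'I_(b + (k + c)) -> int) (x : 'I_k -> F) :
  (0 < k)%N -> q != 0 -> (forall m, (0 < m)%N -> q ^+ m != 1) ->
  injective x -> (forall i m n, q ^+ m * x i != q ^+ n) ->
  schur_block q lambda b x / schur_principal q lambda =
    q ^+ ((k * (k - 1) * (2 * k - 1)) %/ 6)
      / (vandermonde (fun i => x (rev_ord i)) * qvandermonde q k)
    * \det (\matrix_(i < k, j < k)
        (schur_single q lambda b j (x i) / schur_principal q lambda
         * \prod_(s < k | s != j) (x i * q ^- s - 1))).
Proof.
move=> k_gt0 q_neq0 q_root x_inj xq.
pose phi (j : 'I_(b + (k + c))) (w : F) :=
  w ^ (lambda j + (b + (k + c) - j.+1)%N%:Z).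
pose y (m : 'I_(b + (k + c))) := q ^+ m.
pose z := args (qpowers q 0 b ++ [seq q ^+ b * x i | i <- enum 'I_k]
  ++ qpowers q (b + k) (b + (k + c))) : 'I_(b + (k + c)) -> F.
have z_mid i : z (mid b c i) = q ^+ b * x i by apply: args_block_mid.
have yz : agree_off_mid y z by apply: args_block_off_mid.
have expq_neq m n : (m < n)%N -> q ^+ m != q ^+ n.
  move=> ltmn; rewrite -(subnKC (ltnW ltmn)) exprD eq_sym.
  rewrite -subr_eq0 -{2}[q ^+ m]mulr1 -mulrBr mulf_neq0 ?expf_neq0 //.
  by rewrite subr_eq0 q_root // subn_gt0.
have y_inj : injective y.
  move=> m n /eqP eq_mn; apply/val_inj; case: (ltngtP m n) => // ltmn.
    by rewrite (negbTE (expq_neq _ _ ltmn)) in eq_mn.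
  by rewrite eq_sym (negbTE (expq_neq _ _ ltmn)) in eq_mn.
have z_inj : injective z.
  have mid_or_off m : (exists i, m = mid b c i) \/ z m = y m.
    have [/existsP[i /eqP ->]|] := boolP [exists i, m == mid b c i].
      by left; exists i.
    by rewrite negb_exists => /forallP off; right; apply: yz.
  move=> m n; case: (mid_or_off m) (mid_or_off n) => [[i ->]|->] [[j ->]|->].
  - by rewrite !z_mid => /(mulfI (expf_neq0 _ q_neq0)) /x_inj ->.
  - by rewrite z_mid => /eqP; rewrite (negbTE (xq _ _ _)).
  - by rewrite z_mid => /eqP; rewrite eq_sym (negbTE (xq _ _ _)).
  - exact: y_inj.
have -> : schur_principal q lambda = generalized_schur phi y.
  exact/(@eq_generalized_schur _ _ phi)/args_principal.
have -> : schur_block q lambda b x = generalized_schur phi z by [].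
rewrite (generalized_schur_block phi k_gt0 y_inj z_inj yz)
  => [|i s]; last first.
  by rewrite z_mid xq.
(* Absorb the constants of [vandermonde_qpowers_ratio], one per column, into
   the determinant. *)
rewrite -(vandermonde_qpowers_ratio b q_neq0 q_root x_inj).
have -> : vandermonde (z \o @mid b k c) = vandermonde (fun s => q ^+ b * x s).
  by apply: eq_vandermonde => s; rewrite /= z_mid.
rewrite -[RHS]mulrA; congr (_ * _); rewrite [RHS]mulrC.
have := det_scale (\matrix_(i < k, j < k)
  (schur_single q lambda b j (x i) / generalized_schur phi y
   * \prod_(s < k | s != j) (x i * q ^- s - 1)))
  (fun=> 1) (fun j : 'I_k =>
     \prod_(s < k | s != j) (q ^+ s / (q ^+ j - q ^+ s))).
rewrite [\prod_i 1]big1 // mul1r => <-; congr (\det _).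
apply/matrixP=> i j; rewrite !mxE mul1r -[RHS]mulrA -big_split.
have -> : schur_single q lambda b j (x i) =
    generalized_schur phi (replace y (mid b c j) (z (mid b c i))).
  by rewrite z_mid; apply/(@eq_generalized_schur _ _ phi)/args_single.
congr (_ * _); apply: eq_bigr => s sj /=.
rewrite z_mid /y /= !exprD.
have qjs : q ^+ j - q ^+ s != 0.
  rewrite subr_eq0; move: sj; rewrite -val_eqE neq_ltn.
  by case/orP=> /expq_neq //; rewrite eq_sym.
by field; rewrite -mulrBr qjs mulf_neq0 ?expf_neq0.
Qed.

Theorem theorem3p7 (R : realFieldType) (q : R) (b k N : nat)
    (lambda : 'I_N -> int)
    (q_gt0 : 0 < q) (q_lt1 : q < 1)
    (k_gt0 : (0 < k)%N) (N_gt0 : (0 < N)%N) (le_bk_N : (b + k <= N)%N)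
    (lambda_GT : GT lambda) :
  let Q : ratfun R k := ratconst k q in
  let x : 'I_k -> ratfun R k := @ratvar R k in
  schur_block Q lambda b x / schur_principal Q lambda =
    Q ^+ ((k * (k - 1) * (2 * k - 1)) %/ 6)
      / (vandermonde (fun i : 'I_k => x (rev_ord i)) * qvandermonde Q k)
    * \det (\matrix_(i < k, j < k)
        (schur_single Q lambda b j (x i) / schur_principal Q lambda
         * \prod_(s < k | s != j) (x i * Q ^- s - 1))).
Proof.
move=> Q x.
have QX m : Q ^+ m = tofrac ((q ^+ m)%:MP_[k]) by rewrite rmorphXn tofracXn.
have [c def_N] : exists c, N = (b + (k + c))%N.
  by exists (N - (b + k))%N; rewrite addnA subnKC.
subst N; apply: schur_block_det => //.
- by rewrite tofrac_eq0 mpolyC_eq0 gt_eqF.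
- move=> m m_gt0; rewrite QX -tofrac1 tofrac_eq -mpolyC1 mpolyC_eq.
  by rewrite lt_eqF // exprn_ilt1 // ?ltW // -lt0n.
(* Distinct variables are separated by evaluating at a basis vector. *)
- move=> i j /eqP; rewrite tofrac_eq => /eqP.
  move/(congr1 (meval (fun s => (s == i)%:R))); rewrite !mevalXU eqxx.
  by case: eqVneq => // _ /eqP; rewrite oner_eq0.
(* At the origin [q^m x_i] vanishes, whereas the constant [q^n] does not. *)
- move=> i m n; rewrite !QX -tofracM tofrac_eq; apply/eqP.
  move/(congr1 (meval (fun=> 0))); rewrite mevalM !mevalC mevalXU mulr0.
  by move/esym/eqP; rewrite expf_eq0 gt_eqF // andbF.
Qed.
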